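(* Let $(X,\tau,\mathbf{S})$ be a Hausdorff sequentially complete locally convex topological vector space whose topology $\tau$ is generated by the family of seminorms $\mathbf{S}=\{s_k\}_{k\in\mathbf{I}}$, where $\mathbf{I}$ is an index set. Let $f:X\to\mathbb{R}\cup\{+\infty\}$ be a proper and sequentially lower semicontinuous from above function that is bounded from below. Let $\mathbf{\Lambda}=\{\lambda_k\}_{k\in\mathbf{I}}$ be a family of positive numbers indexed by the same set $\mathbf{I}$. Consider the set-valued map $$S(x):=\{y\in X:\ \lambda_k s_k(y-x)\le f(x)-f(y)\ \text{ for all } k\in\mathbf{I}\},$$ where the inequality is understood as $f(y)+\lambda_k s_k(y-x)\le f(x)$ in $\mathbb{R}\cup\{+\infty\}$. Then there exists $\bar{x}\in X$ such that $S(\bar{x})=\{\bar{x}\}$.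
   Context: $X$ is a vector space and $\mathbf{S}$ is a family of seminorms on $X$ that separates points (for each $x\in X\setminus\{0\}$ there is $s\in\mathbf{S}$ with $s(x)>0$); $\tau$ is the locally convex topology generated by $\mathbf{S}$. For $f:X\to\mathbb{R}\cup\{+\infty\}$, $\operatorname{dom}f:=\{x\in X: f(x)<+\infty\}$, and $f$ is proper if $\operatorname{dom} f\neq\emptyset$. $f$ is (sequentially) lower semicontinuous from above if for every sequence $\{x_i\}_{i=1}^\infty\subset\operatorname{dom} f$ such that $x_i\to x$ and $\{f(x_i)\}_{i=1}^\infty$ is decreasing, i.e. $f(x_i)>f(x_{i+1})$ for all $i$, it holds that $f(x)\le f(x_i)$ for all $i\in\mathbb{N}$. *)

(* Defs.v *)
From mathcomp Require Import all_boot all_order all_algebra.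
From mathcomp Require Import all_classical reals ereal topology normedtype.

Set Implicit Arguments.
Unset Strict Implicit.
Unset Printing Implicit Defensive.

Import Order.TTheory GRing.Theory Num.Theory.
Import numFieldNormedType.Exports.

Local Open Scope classical_set_scope.
Local Open Scope ring_scope.

Record seminorm (R : realType) (X : lmodType R) (p : X -> R) : Prop := Seminorm {
  seminorm_ge0 : forall x, 0 <= p x;
  seminormZ : forall (a : R) (x : X), p (a *: x) = `|a| * p x;
  seminormD : forall x y, p (x + y) <= p x + p y
}.

Definition separates_points (R : realType) (X : lmodType R) (I : Type)
    (s : I -> X -> R) : Prop :=
  forall x : X, x != 0 -> exists k, 0 < s k x.

(* The neighbourhoods of x are the supersets of the finite intersections of
   seminorm balls centered at x; for J = set0 the intersection is setT. *)
Definition topology_generated_by (R : realType) (X : tvsType R) (I : Type)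
    (s : I -> X -> R) : Prop :=
  forall (x : X) (A : set X),
    nbhs x A <->
    exists J : set I, exists e : R,
      [/\ finite_set J, 0 < e &
          [set y | forall k, J k -> s k (y - x) < e] `<=` A].

(* A tvsType carries a uniform structure inducing its topology, but nothing
   forces that structure to be translation invariant; the Cauchy property of
   topological vector spaces is therefore stated with neighbourhoods of 0
   instead of the library's [cauchy]. *)
Definition tvs_cauchy_seq (R : realType) (X : tvsType R) (u : nat -> X) : Prop :=
  forall U : set X, nbhs (0 : X) U ->
    exists N : nat, forall m n, (N <= m)%N -> (N <= n)%N -> U (u m - u n).

Definition sequentially_complete (R : realType) (X : tvsType R) : Prop :=
  forall u : nat -> X, tvs_cauchy_seq u -> exists x : X, u @ \oo --> x.

Definition edom (R : realType) (X : Type) (f : X -> \bar R) : set X :=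
  [set x | (f x < +oo)%E].

Definition proper_fun (R : realType) (X : Type) (f : X -> \bar R) : Prop :=
  edom f !=set0.

Definition bounded_from_below (R : realType) (X : Type) (f : X -> \bar R) : Prop :=
  exists m : R, forall x, (m%:E <= f x)%E.

Definition seq_lsc_from_above (R : realType) (X : topologicalType)
    (f : X -> \bar R) : Prop :=
  forall (u : nat -> X) (x : X),
    (forall i, edom f (u i)) ->
    u @ \oo --> x ->
    (forall i, (f (u i.+1) < f (u i))%E) ->
    forall i, (f x <= f (u i))%E.

Definition Smap (R : realType) (X : lmodType R) (I : Type) (s : I -> X -> R)
    (lambda : I -> R) (f : X -> \bar R) (x : X) : set X :=
  [set y | forall k, (f y + (lambda k * s k (y - x))%:E <= f x)%E].

(* Main.v *)
(** The relation [y \in S x] is a preorder along which [f] decreases, strictly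
    away from [x]. If no point were minimal, one could choose [x_(n+1)] in
    [S x_n] with [f x_(n+1)] strictly below [f x_n] and below the midpoint of
    [f x_n] and [inf f] over [S x_n]. Since [lambda_k s_k(x_m - x_n)] is at most
    [f x_n - f x_m], the sequence is Cauchy; its limit [x] lies in every [S x_n]
    by lower semicontinuity from above. Any [z] in [S x] then lies in every
    [S x_n], so [f z >= 2 f x_(n+1) - f x_n] for all [n]; in the limit
    [f z >= f x], which forces [z = x]. *)

Require Import Defs.
From mathcomp Require Import all_boot all_order all_algebra.
From mathcomp Require Import all_classical reals ereal topology normedtype.
From mathcomp Require Import lra.

Set Implicit Arguments.
Unset Strict Implicit.
Unset Printing Implicit Defensive.

Import Order.TTheory GRing.Theory Num.Theory.
Import numFieldNormedType.Exports.

Local Open Scope classical_set_scope.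
Local Open Scope ring_scope.

Section Seminorms.
Variables (R : realType) (X : lmodType R).
Implicit Types p : X -> R.

Lemma seminorm0 p : seminorm p -> p 0 = 0.
Proof. by move=> hp; have := seminormZ hp 0 0; rewrite scale0r normr0 mul0r. Qed.

Lemma seminormBC p x y : seminorm p -> p (x - y) = p (y - x).
Proof.
move=> hp; rewrite -[x - y]opprB -(scaleN1r (y - x)) (seminormZ hp).
by rewrite normrN normr1 mul1r.
Qed.

Lemma seminorm_triangle p x y z :
  seminorm p -> p (x - z) <= p (x - y) + p (y - z).
Proof. by move=> hp; rewrite -(subrKA y) (seminormD hp). Qed.

End Seminorms.

Lemma fine_edom (R : realType) (X : Type) (f : X -> \bar R) x :
  (forall x, f x <> -oo%E) -> edom f x -> f x = (fine (f x))%:E.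
Proof. by move=> hf; rewrite /edom/=; case: (f x) (hf x). Qed.

Section GeneratedTopology.
Variables (R : realType) (X : tvsType R) (I : Type) (s : I -> X -> R).
Hypotheses (hs : forall k, seminorm (s k)) (htop : topology_generated_by s).

Lemma cvg_seminorm (u : nat -> X) x k (e : R) :
  u @ \oo --> x -> 0 < e -> \forall n \near \oo, s k (u n - x) < e.
Proof.
move=> ux e0; apply: (ux [set y | s k (y - x) < e]).
apply/htop; exists [set k], e; split => //.
by move=> y /= /(_ k erefl).
Qed.

(** A neighbourhood of 0 constrains only finitely many seminorms, so the largest of their thresholds
    serves for all. Passing through [u (N k)] costs two halves of [e]. *)
Lemma seminorm_tvs_cauchy (u : nat -> X) :
  (forall k (e : R), 0 < e ->
    exists N, forall n, (N <= n)%N -> s k (u n - u N) < e) ->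
  tvs_cauchy_seq u.
Proof.
move=> uC U /htop[J [e [Jfin e0 JU]]].
have uN k : exists N, forall n, (N <= n)%N -> s k (u n - u N) < e / 2.
  by apply: uC; rewrite divr_gt0.
have [N Nu] := choice uN.
(* The thresholds are enumerated rather than [J], since [I] is a bare type with no decidable
   equality. *)
have : finite_set (N @` J) by exact: finite_image.
move=> /finite_seqP[K NJK].
exists (\max_(i <- K) i)%N => m n Mm Mn; apply: JU => k Jk; rewrite subr0.
rewrite (le_lt_trans (seminorm_triangle _ (u (N k)) _ (hs k)))//.
have NM : (N k <= \max_(i <- K) i)%N.
  apply: (@leq_bigmax_seq _ _ xpredT id) => //.
  by have : (N @` J) (N k) by [exists k]; rewrite NJK.
rewrite (splitr e) ltrD// ?(seminormBC (u (N k)) _ (hs k))// Nu//;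
  exact: (leq_trans NM).
Qed.

End GeneratedTopology.

Section Order.
Variables (R : realType) (X : lmodType R) (I : Type) (s : I -> X -> R).
Variables (lambda : I -> R) (f : X -> \bar R).
Hypotheses (hs : forall k, seminorm (s k)) (hsep : separates_points s).
Hypothesis hlambda : forall k, 0 < lambda k.
Hypothesis hf_ninfty : forall x, f x <> -oo%E.

Local Notation S := (Smap s lambda f).
Local Notation g := (fun x => fine (f x)).

Lemma Smap_refl x : S x x.
Proof. by move=> k; rewrite subrr seminorm0// mulr0 adde0. Qed.

(** This moves the order from extended to real values. The index [k0] makes [f y] finite: over an
    empty [I], [S x] would be the whole space. *)
Lemma Smap_edomP (k0 : I) x y : edom f x ->
  S x y <-> edom f y /\ forall k, lambda k * s k (y - x) <= g x - g y.
Proof.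
move=> fx; split=> [Sxy|[fy Sxy] k].
  have fy : edom f y.
    have := le_lt_trans (Sxy k0) fx.
    by rewrite /edom/= !ltey; case: (f y).
  split=> // k; have := Sxy k.
  rewrite (fine_edom hf_ninfty fx) (fine_edom hf_ninfty fy) /= lee_fin.
  by rewrite lerBrDl.
rewrite (fine_edom hf_ninfty fx) (fine_edom hf_ninfty fy) -EFinD lee_fin -lerBrDl.
exact: Sxy.
Qed.

Lemma Smap_trans (k0 : I) x y z : edom f x -> S x y -> S y z -> S x z.
Proof.
move=> fx /(Smap_edomP k0 _ fx)[fy xy] /(Smap_edomP k0 _ fy)[fz yz].
apply/(Smap_edomP k0 _ fx); split=> // k.
have := seminorm_triangle z y x (hs k).
rewrite -(ler_pM2l (hlambda k)) mulrDr => /le_trans; apply.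
by rewrite (le_trans (lerD (yz k) (xy k)))// addrC subrKA.
Qed.

(** Otherwise some seminorm would be positive at [y - x], while its multiple by [lambda k] is at
    most [g x - g y <= 0]. *)
Lemma Smap_fine_eq (k0 : I) x y : edom f x -> S x y -> g x <= g y -> y = x.
Proof.
move=> fx /(Smap_edomP k0 _ fx)[_ xy] gxy; apply/eqP; rewrite -subr_eq0.
apply/negPn/negP => /hsep[k]; rewrite ltNge => /negP; apply.
by rewrite -(pmulr_rle0 _ (hlambda k)) (le_trans (xy k))// subr_le0.
Qed.

(* The bound says that [g y] is at most the midpoint of [g x] and the infimum
   of [g] over [S x]. *)
Lemma Smap_halving (k0 : I) x : bounded_from_below f -> edom f x ->
  S x <> [set x] ->
  exists y, [/\ S x y, g y < g x & forall z, S x z -> 2 * g y - g x <= g z].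
Proof.
move=> [m fm] fx Sx.
have [y [Sxy yx]] : exists y, S x y /\ y <> x.
  apply: contrapT => /forallNP noy; apply: Sx; rewrite eqEsubset; split.
    by move=> y Sxy; apply: contrapT => yx; exact: (noy y).
  by move=> _ ->; exact: Smap_refl.
have gyx : g y < g x.
  rewrite ltNge; apply/negP => gxy; apply: yx.
  exact: (Smap_fine_eq k0 fx Sxy).
have hinf : has_inf (g @` S x).
  split; first by exists (g y), y.
  exists m => _ [z /(Smap_edomP k0 _ fx)[fz _] <-].
  by have := fm z; rewrite (fine_edom hf_ninfty fz) lee_fin.
have infy : inf (g @` S x) <= g y by apply: ge_inf; [case: hinf | exists y].
have e0 : 0 < (g x - inf (g @` S x)) / 2.
  by rewrite divr_gt0// subr_gt0 (le_lt_trans infy).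
have [_ [z Sxz <-]] := inf_adherent e0 hinf => gz.
exists z; split=> //; first by move: gz infy gyx => /=; lra.
move=> w Sxw.
have : inf (g @` S x) <= g w by apply: ge_inf; [case: hinf | exists w].
move: gz => /=; lra.
Qed.

End Order.

Theorem theorem3p4 (R : realType) (X : tvsType R) (I : Type)
    (s : I -> X -> R) (lambda : I -> R) (f : X -> \bar R)
    (hs : forall k, seminorm (s k))
    (hsep : separates_points s)
    (htop : topology_generated_by s)
    (hX2 : hausdorff_space X)
    (hXc : sequentially_complete X)
    (hf_ninfty : forall x, f x <> -oo%E)
    (hf_proper : proper_fun f)
    (hf_lsc : seq_lsc_from_above f)
    (hf_bnd : bounded_from_below f)
    (hlambda : forall k, 0 < lambda k) :
  exists xbar : X, Smap s lambda f xbar = [set xbar].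
Proof.
apply: contrapT => /forallNP noS.
have [x0 fx0] := hf_proper.
(* With no index, separation of points leaves only 0 in [X], and [S 0] is then trivially a
   singleton. *)
have [k0] : inhabited I.
  apply: contrapT => I0; apply: (noS 0); rewrite eqEsubset; split.
    move=> y _ /=; apply: contrapT => /eqP /hsep[k _].
    by apply: I0; exists.
  by move=> _ -> k; case: I0; exists.
pose S := Smap s lambda f; pose g x := fine (f x).
have step x : exists y, edom f x ->
    [/\ S x y, g y < g x & forall z, S x z -> 2 * g y - g x <= g z].
  (* Outside the domain [x] is a dummy value, so that [choice] yields a total map. *)
  have [fx|nfx] := pselect (edom f x); last by exists x.
  have [y] := Smap_halving hs hsep hlambda hf_ninfty k0 hf_bnd fx (noS x).
  by exists y.
have [F hF] := choice step.
pose u n := iter n F x0.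
have SP x y := @Smap_edomP _ _ _ s lambda f hf_ninfty k0 x y.
have fu n : edom f (u n).
  by elim: n => //= n ih; have [/SP - /(_ ih)[]] := hF _ ih.
have gS n : g (u n.+1) < g (u n) by have [] := hF _ (fu n).
have Su n m : (n <= m)%N -> S (u n) (u m).
  elim: m => [|m ih]; first by rewrite leqn0 => /eqP ->; exact: Smap_refl.
  rewrite leq_eqVlt => /orP[/eqP ->|]; first exact: Smap_refl.
  rewrite ltnS => /ih nm.
  apply: (Smap_trans hs hlambda hf_ninfty k0 (fu n) nm).
  by have [] := hF _ (fu m).
have hinf : has_inf (range (g \o u)).
  split; first by exists (g (u 0%N)), 0%N.
  have [m fm] := hf_bnd; exists m => _ [n _ <-].
  by have := fm (u n); rewrite (fine_edom hf_ninfty (fu n)) lee_fin.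
pose L := inf (range (g \o u)).
have Lg n : L <= g (u n) by apply: ge_inf; [case: hinf | exists n].
have gL e : 0 < e -> exists N, g (u N) < L + e.
  by move=> e0; have [_ [N _ <-]] := inf_adherent e0 hinf; exists N.
have [x ux] : exists x : X, u @ \oo --> x.
  apply: hXc; apply: (seminorm_tvs_cauchy hs htop) => k e e0.
  (* For [n >= N], [lambda k * s k (u n - u N)] is at most [g (u N) - g (u n) <= g (u N) - L <
     lambda k * e]. *)
  have [N gN] := gL (lambda k * e) (mulr_gt0 (hlambda k) e0).
  exists N => n Nn; rewrite -(ltr_pM2l (hlambda k)).
  have /SP - /(_ (fu N))[_ /(_ k)/le_lt_trans] := Su _ _ Nn; apply.
  by rewrite -/(g _) -/(g (u n)); have := Lg n; lra.
have fxu n : (f x <= f (u n))%E.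
  apply: (hf_lsc u x fu ux) => i.
  rewrite (fine_edom hf_ninfty (fu i)) (fine_edom hf_ninfty (fu i.+1)) lte_fin.
  exact: gS.
have fx : edom f x by exact: le_lt_trans (fxu 0%N) (fu 0%N).
have gxu n : g x <= g (u n).
  by have := fxu n; rewrite (fine_edom hf_ninfty (fu n)) (fine_edom hf_ninfty fx).
have gxL : g x <= L.
  by apply: lb_le_inf; [case: hinf | move=> _ [n _ <-]; exact: gxu].
have Sux n : S (u n) x.
  apply/(SP _ _ (fu n)); split=> // k.
  rewrite mulrC -ler_pdivlMr//; apply/ler_addgt0Pr => e e0.
  have [N _ sN] := cvg_seminorm htop k ux e0.
  (* [u M] is both in [S (u n)] and within [e] of [x]; the inequality for [u M] is weakened by
     [g x <= g (u M)]. *)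
  pose M := maxn n N.
  have sM : s k (u M - x) < e by apply: sN; exact: leq_maxr.
  have := seminorm_triangle x (u M) (u n) (hs k).
  rewrite (seminormBC x (u M) (hs k)) => /le_trans; apply.
  rewrite [leRHS]addrC lerD ?(ltW sM)// ler_pdivlMr// mulrC.
  have /SP - /(_ (fu n))[_ /(_ k)/le_trans] := Su n M (leq_maxl _ _); apply.
  by rewrite lerB// gxu.
apply: (noS x); rewrite eqEsubset; split; last by move=> _ ->; exact: Smap_refl.
move=> z Sxz; apply: (Smap_fine_eq hsep hlambda hf_ninfty k0 fx Sxz).
(* Once [g (u N) < L + e], the midpoint bound gives [g z >= 2 * g (u N.+1) - g (u N) >= 2 * L - (L +
   e) = L - e]. *)
apply: (le_trans gxL); apply/ler_addgt0Pr => e e0.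
have [N gN] := gL e e0.
have [_ _ /(_ z)] := hF _ (fu N).
have Suz : S (u N) z.
  exact: (Smap_trans hs hlambda hf_ninfty k0 (fu N) (Sux N)).
move=> /(_ Suz); have := Lg N.+1; rewrite -/(g z) /=; lra.
Qed.
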